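(* For $n\ge 0$, let $g:\mathcal{P}_n\to\mathcal{B}_n$ be the bijection (defined in the context) from the faro permutations of length $n$ to the dispersed Dyck paths of length $n$. For a pattern $p$, let $\mathbf{p}$ denote the statistic counting occurrences of $p$ as a consecutive pattern. Then for every $w\in\mathcal{P}_n$, with $P=g(w)$: (1) $\mathbf{21}(w)=\mathbf{U}(P)$; (2) $\mathbf{12}(w)=\mathbf{DU}(P)+\mathbf{DD}(P)+\mathbf{DF}(P)+\mathbf{FF}(P)+\mathbf{FU}(P)=n-1-\mathbf{U}(P)$; (3) $\mathbf{132}(w)=\mathbf{FU}(P)+\mathbf{UU}(P)+\mathbf{DU}(P)$; (4) $\mathbf{213}(w)=\mathbf{DF}(P)+\mathbf{DD}(P)+\mathbf{DU}(P)$; (5) $\mathbf{123}(w)=\mathbf{DFU}(P)+\mathbf{DFF}(P)+\mathbf{FFU}(P)+\mathbf{FFF}(P)=n-2-\mathbf{FU}(P)-\mathbf{UU}(P)-2\,\mathbf{DU}(P)-\mathbf{DF}(P)-\mathbf{DD}(P)$; (6) $\mathbf{231}(w)=\mathbf{312}(w)=\mathbf{321}(w)=0$.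
   Context: Faro permutations: a $k$-ary faro word of length $n$ is a word $w$ over $\{1,\dots,k\}$ of the form $u_1v_1u_2v_2u_3v_3\cdots$ with $u,v$ nondecreasing and $0\le|u|-|v|\le1$, $|u|+|v|=n$ (equivalently, $w_i\le w_{i+2}$ for all $1\le i\le n-2$). A faro permutation of length $n$ is an $n$-ary faro word of length $n$ containing every letter of $\{1,\dots,n\}$ exactly once; $\mathcal{P}_n$ is the set of these. A pair in a faro word $w$ is an occurrence of consecutive letters $w_iw_{i+1}$ with $w_i>w_{i+1}$; no letter belongs to two pairs. A singleton is a letter not belonging to any pair. Paths: a dispersed Dyck path of length $n$ is a lattice path from $(0,0)$ to $(n,0)$ with steps $F=(1,0)$, $U=(1,1)$, $D=(1,-1)$, never going below the $x$-axis, all of whose level steps $F$ lie on the $x$-axis. $\mathcal{B}_n$ is the set of these. The map $g$: for $w\in\mathcal{P}_n$, put $$f(w)=F^{T_0}U^{T_1}D^{T_2}F^{T_3}\cdots F^{T_{3(n-2)}}U^{T_{3(n-2)+1}}D^{T_{3(n-2)+2}}F^{T_{3(n-1)}},$$ where $T_{3(x-1)}$ ($1\le x\le n$) is the number of occurrences of the singleton $x$ in $w$; $T_{3(x-1)-1}$ ($2\le x\le n$) is one plus the number of pairs $xy$ with $y<x$ in $w$; $T_{3(x-1)+1}$ ($1\le x\le n-1$) is one plus the number of pairs $yx$ with $y>x$ in $w$. In $f(w)$ any two consecutive occurrences of $UD$ are separated by exactly one step, and $g(w)$ is obtained from $f(w)$ by (simultaneously) removing all occurrences of $UD$ of $f(w)$.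 E.g. for $w=1243576$, $f(w)=FUDFUDUUDDUDFUDUUDD$ and $g(w)=FFUDFUD$. (For $n=0$, $g$ maps the empty permutation to the empty path.) The map $g$ is a bijection $\mathcal{P}_n\to\mathcal{B}_n$. An occurrence of a consecutive pattern $p=p_1\cdots p_m$ in a permutation $w$ is a factor $w_iw_{i+1}\cdots w_{i+m-1}$ order-isomorphic to $p$; an occurrence of a step-word in a path is an occurrence as consecutive steps.
   Formalization: The last equality in (2), with n-1-U(P), is stated only for n≥1, and the last equality in (5), with n-2-..., only for n≥2; they are false for n=0 (0=-1) and for n=0,1 (0=-2, 0=-1) respectively. *)

(* Defs.v *)
From HB Require Import structures.
From mathcomp Require Import all_boot.

Set Implicit Arguments.
Unset Strict Implicit.
Unset Printing Implicit Defensive.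

Fixpoint interleave (u v : seq nat) : seq nat :=
  match u, v with
  | x :: u', y :: v' => x :: y :: interleave u' v'
  | [::], _ => v
  | _, [::] => u
  end.

Definition faro_word (k n : nat) (w : seq nat) : Prop :=
  all (fun x => 1 <= x <= k) w /\
  exists u v : seq nat,
    [/\ sorted leq u, sorted leq v, size v <= size u <= (size v).+1,
        size u + size v = n & w = interleave u v].

Definition faro_permutation (n : nat) (w : seq nat) : Prop :=
  faro_word n n w /\ forall x, 1 <= x <= n -> count_mem x w = 1.

(* Positions are 0-based: the consecutive letters at positions i and i.+1 form
   a pair. *)
Definition pair_at (w : seq nat) (i : nat) : bool :=
  (i.+1 < size w) && (nth 0 w i.+1 < nth 0 w i).

Definition singleton_at (w : seq nat) (i : nat) : bool :=
  [&& i < size w, ~~ pair_at w i & ~~ ((0 < i) && pair_at w i.-1)].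

Definition num_singleton (w : seq nat) (x : nat) : nat :=
  count (fun i => singleton_at w i && (nth 0 w i == x)) (iota 0 (size w)).

Definition num_pair_fst (w : seq nat) (x : nat) : nat :=
  count (fun i => pair_at w i && (nth 0 w i == x)) (iota 0 (size w)).

Definition num_pair_snd (w : seq nat) (x : nat) : nat :=
  count (fun i => pair_at w i && (nth 0 w i.+1 == x)) (iota 0 (size w)).

Inductive step : Type := F | U | D.

Definition step_eqb (a b : step) : bool :=
  match a, b with
  | F, F | U, U | D, D => true
  | _, _ => false
  end.

Lemma step_eqP : Equality.axiom step_eqb.
Proof. by case; case; constructor. Qed.

HB.instance Definition _ := hasDecEq.Build step step_eqP.

(* Exponent of the j-th block of f (w). Solving for the letter x, j = 3 (x - 1) and j = 3 (x - 1) + 1 give x = j %/ 3 + 1, whereas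
   j = 3 (x - 1) - 1 gives x = j %/ 3 + 2. *)
Definition T (w : seq nat) (j : nat) : nat :=
  match j %% 3 with
  | 0 => num_singleton w (j %/ 3).+1
  | 1 => (num_pair_snd w (j %/ 3).+1).+1
  | _ => (num_pair_fst w (j %/ 3).+2).+1
  end.

Definition step_of (j : nat) : step :=
  match j %% 3 with 0 => F | 1 => U | _ => D end.

(* The indices are 0 <= j <= 3 (n - 1), that is j < 3 n - 2; there are none
   when n = 0. *)
Definition f (n : nat) (w : seq nat) : seq step :=
  flatten [seq nseq (T w j) (step_of j) | j <- iota 0 (3 * n - 2)].

(* Distinct occurrences of UD never overlap, so one left-to-right pass removes
   exactly the occurrences present in the argument. UD's created by the removal
   are kept. *)
Fixpoint remove_UD (s : seq step) : seq step :=
  match s with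
  | U :: D :: s' => remove_UD s'
  | a :: s' => a :: remove_UD s'
  | [::] => [::]
  end.

Definition g (n : nat) (w : seq nat) : seq step := remove_UD (f n w).

Definition factors (A : Type) (m : nat) (s : seq A) : seq (seq A) :=
  [seq take m (drop i s) | i <- iota 0 ((size s).+1 - m)].

Definition order_isomorphic (s p : seq nat) : bool :=
  (size s == size p) &&
  [forall i : 'I_(size p), forall j : 'I_(size p),
     (nth 0 s i < nth 0 s j) == (nth 0 p i < nth 0 p j)].

Definition occ_perm (p w : seq nat) : nat :=
  count (fun s => order_isomorphic s p) (factors (size p) w).

Definition occ_path (p P : seq step) : nat :=
  count (fun s => s == p) (factors (size p) P).

(* Main.v *)
Require Import Defs.
From mathcomp Require Import all_boot all_order all_algebra zify.
Import Order.TTheory GRing.Theory Num.Theory.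

Set Implicit Arguments.
Unset Strict Implicit.
Unset Printing Implicit Defensive.

(** The map [g] reads off the roles of the letters in increasing order of their
    values.  Grouping the blocks of [f n w] by letter, the letter [x]
    contributes D^(1+a) F^s U^(1+b), where [a], [s], [b] record whether [x] is
    the larger letter of a pair, a singleton, or the smaller letter of a pair;
    the initial D of the letter 1 and the final U of the letter [n] are left
    out.  Between the letters [x] and [x.+1] there is exactly one peak UD, which
    uses up the two summands 1, and removing all the peaks leaves D^a F^s U^b
    for each letter.  Exactly one of [a], [s], [b] is 1, so the [x]-th step of
    [g n w] is D, F or U according to the role of [x] in [w]
    ([g_letter_roles]).

    Everything else compares the permutation with this word of roles.

    - In a faro permutation [w_i < w_(i+2)], so a window of three letters has
      shape 123, 132 or 213, and the shape is determined by which of its two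
      pairs of neighbours are descents.  Hence 132 counts the descents that do
      not start [w], 213 those that do not end it, and 123 takes up the
      remaining windows ([occ_perm_132], [occ_perm_213], [occ_perm_123]).

    - Each descent has one larger and one smaller letter, so U and D both occur
      as often as there are descents.  The first step is never D, and is U when
      [w] starts with a descent; the last step is never U, and is D when [w]
      ends with one ([role_first_letter_U], [role_last_letter_D]).

    - A singleton is larger than all letters before it and smaller than all
      letters after it, so no pair has one letter below it and the other above
      it, and the factors UF and FD never occur ([allowed_letter_roles]).

    - In any word, the factors of length two that end with a given letter number
      its occurrences other than an initial one, and those that begin with it
      its occurrences other than a final one ([occ_path_into],
      [occ_path_from]).  Without UF and FD, the four factors DFU, DFF, FFU, FFF
      count the F's that are neither first nor last ([count_F_interior]).

    The identities of the theorem are linear consequences of these counts. *)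

(** * Faro permutations *)

Definition skip_increasing (w : seq nat) : Prop :=
  forall i, i.+2 < size w -> nth 0 w i < nth 0 w i.+2.

(** Positions of equal parity carry letters of the same word, since the balance
    of the sizes leaves at most one letter of [u] after [v] is exhausted. *)
Lemma interleave_skip u v i : sorted leq u -> sorted leq v ->
  size v <= size u <= (size v).+1 -> i.+2 < size (interleave u v) ->
  nth 0 (interleave u v) i <= nth 0 (interleave u v) i.+2.
Proof.
elim: u v i => [|x u IHu] [|y v] i //=.
  by case: u {IHu} => [|x' u] //=; rewrite andbF.
move=> xu yv szuv; case: i => [|[|i]] /= szi; last first.
  by apply: IHu => //; [exact: path_sorted xu|exact: path_sorted yv].
all: case: u {IHu} xu szuv szi => [|x' u]; case: v yv => [|y' v] //=.
all: try by case/andP.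
all: try by move=> _ /andP[].
  by case: u => // ? ?; lia.
Qed.

Lemma faro_permutation_perm n w : faro_permutation n w -> perm_eq w (iota 1 n).
Proof.
move=> [[/allP w_le _] w_once]; apply/allP => x; rewrite mem_cat => x_in.
have x_range : 1 <= x <= n.
  by case/orP: x_in => [/w_le //|]; rewrite mem_iota; lia.
rewrite /= w_once // count_uniq_mem ?iota_uniq // mem_iota.
by have -> : (1 <= x < 1 + n) by lia.
Qed.

Lemma faro_permutation_uniq n w : faro_permutation n w -> uniq w.
Proof. by move/faro_permutation_perm/perm_uniq->; exact: iota_uniq. Qed.

Lemma faro_permutation_skip n w : faro_permutation n w -> skip_increasing w.
Proof.
move=> hw i szi; rewrite ltn_neqAle.
rewrite nth_uniq ?(faro_permutation_uniq hw) ?(ltnW (ltnW szi)) //.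
have -> /= : i != i.+2 by lia.
case: hw => -[_ [u [v [su sv suv _ w_uv]]]] _; subst w.
exact: interleave_skip.
Qed.

(** * Roles of the letters *)

Definition pair_before (w : seq nat) (i : nat) : bool :=
  (0 < i) && pair_at w i.-1.

Definition role (w : seq nat) (i : nat) : step :=
  if pair_at w i then D else if pair_before w i then U else F.

Definition letter_role (w : seq nat) (x : nat) : step := role w (index x w).

(** Two consecutive descents would give [w_i > w_(i+2)]. *)
Lemma pairs_disjoint w i : skip_increasing w ->
  pair_at w i -> ~~ pair_at w i.+1.
Proof.
move=> skip; rewrite /pair_at => /andP[_ lt1]; apply/negP => /andP[szi lt2].
by have := skip _ szi; lia.
Qed.

Lemma role_D w i : (role w i == D) = pair_at w i.
Proof. by rewrite /role; case: pair_at; case: pair_before. Qed.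

Lemma role_U w i : skip_increasing w -> (role w i == U) = pair_before w i.
Proof.
move=> skip; rewrite /role; case: ifP => [pi|_]; last by case: pair_before.
case: i pi => [|i] // pi; rewrite /pair_before /=.
by case E: (pair_at w i) => //; have := pairs_disjoint skip E; rewrite pi.
Qed.

Lemma role_F w i : i < size w -> (role w i == F) = singleton_at w i.
Proof.
by move=> szi; rewrite /role /singleton_at szi -/(pair_before w i);
  case: pair_at; case: pair_before.
Qed.

Lemma count_at_letter (q : pred nat) w x : uniq w -> x \in w ->
  count (fun i => q i && (nth 0 w i == x)) (iota 0 (size w)) = q (index x w).
Proof.
move=> uw xw; have szx : index x w < size w by rewrite index_mem.
rewrite (@eq_in_count _ _ (fun i => q (index x w) && (i == index x w))).
  case: (q _) => /=; last exact: count_pred0.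
  by rewrite count_uniq_mem ?iota_uniq // mem_iota szx.
move=> i; rewrite mem_iota => /= szi.
rewrite -{1}(nth_index 0 xw) nth_uniq //.
by case: eqP => [->|]; rewrite ?andbF.
Qed.

Lemma count_iota_succ (q : pred nat) m :
  count q (iota 1 m) = count (fun i => q i.+1) (iota 0 m).
Proof. by rewrite (iotaDl 1 0) count_map. Qed.

Lemma count_iota_last (q : pred nat) m :
  count q (iota 0 m.+1) = count q (iota 0 m) + q m.
Proof. by rewrite -addn1 iotaD count_cat /= addn0. Qed.

(** Counting the pairs by their second positions instead of their first ones.
    The range may be kept because the last position starts no pair. *)
Lemma count_pair_before (q : nat -> nat -> bool) w :
  count (fun i => pair_before w i && q i.-1 i) (iota 0 (size w)) =
  count (fun i => pair_at w i && q i i.+1) (iota 0 (size w)).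
Proof.
set b := fun i => _; have := count_iota_last b (size w).
have -> : b (size w) = false.
  by rewrite /b /pair_before /pair_at; case: (size w) => //= m; rewrite ltnn.
rewrite /= addn0 => <-; exact: count_iota_succ.
Qed.

Lemma num_pair_fstE (w : seq nat) x : uniq w -> x \in w ->
  num_pair_fst w x = (letter_role w x == D).
Proof. by move=> uw xw; rewrite /num_pair_fst count_at_letter // role_D. Qed.

Lemma num_singletonE (w : seq nat) x : uniq w -> x \in w ->
  num_singleton w x = (letter_role w x == F).
Proof.
by move=> uw xw; rewrite /num_singleton count_at_letter // role_F ?index_mem.
Qed.

Lemma num_pair_sndE (w : seq nat) x : uniq w -> skip_increasing w -> x \in w ->
  num_pair_snd w x = (letter_role w x == U).
Proof.
move=> uw skip xw; rewrite /num_pair_snd.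
rewrite -(count_pair_before (fun _ j => nth 0 w j == x)).
by rewrite count_at_letter // role_U.
Qed.

(** * The path is the word of roles *)

Lemma remove_UD_D a s : remove_UD (nseq a D ++ s) = nseq a D ++ remove_UD s.
Proof. by elim: a => //= a ->. Qed.

Lemma remove_UD_F a s : remove_UD (nseq a F ++ s) = nseq a F ++ remove_UD s.
Proof. by elim: a => //= a ->. Qed.

(** Only the peak at the junction goes away: the steps that meet after the
    removal may form a new UD, which the same pass does not remove. *)
Lemma remove_UD_peak b a s :
  remove_UD (U :: nseq b U ++ D :: nseq a D ++ s) =
  nseq b U ++ nseq a D ++ remove_UD s.
Proof. by elim: b => [|b /= ->] //=; rewrite remove_UD_D. Qed.

(** Grouping the blocks by threes, from the U's of a letter to the F's of its
    successor, puts each peak inside one group. *)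
Lemma f_blocks w k m :
  flatten [seq nseq (T w j) (step_of j) | j <- iota (3 * k).+1 (3 * m)] =
  flatten [seq nseq (num_pair_snd w x).+1 U ++
               nseq (num_pair_fst w x.+1).+1 D ++
               nseq (num_singleton w x.+1) F | x <- iota k.+1 m].
Proof.
elim: m k => [|m IHm] k; first by rewrite muln0.
have -> : 3 * m.+1 = (3 * m).+3 by lia.
have e0 : (3 * k).+4 = (3 * k.+1).+1 by lia.
rewrite [iota (3 * k).+1 _]/= e0 /= IHm /T /step_of.
have [-> ->] : (3 * k).+1 %% 3 = 1 /\ (3 * k).+1 %/ 3 = k by lia.
have [-> ->] : (3 * k).+2 %% 3 = 2 /\ (3 * k).+2 %/ 3 = k by lia.
have [-> ->] : (3 * k).+3 %% 3 = 0 /\ (3 * k).+3 %/ 3 = k.+1 by lia.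
by rewrite /= -!catA /= -!catA.
Qed.

Lemma remove_UD_blocks (a s b : nat -> nat) xs :
  remove_UD (flatten [seq nseq (b x).+1 U ++ nseq (a x.+1).+1 D ++
                          nseq (s x.+1) F | x <- xs]) =
  flatten [seq nseq (b x) U ++ nseq (a x.+1) D ++ nseq (s x.+1) F | x <- xs].
Proof.
elim: xs => // x xs IHxs.
rewrite [flatten _]/= [in RHS]/= -!catA cat_cons -catA.
by rewrite remove_UD_peak remove_UD_F IHxs.
Qed.

(** Shifting the grouping back to one letter per group: since exactly one of
    [a x], [s x], [b x] is 1, the group of [x] is the single step [r x]. *)
Lemma regroup_blocks (a s b : nat -> nat) (r : nat -> step) k m :
  (forall x, k <= x <= k + m ->
     [/\ a x = (r x == D), s x = (r x == F) & b x = (r x == U)]) ->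
  nseq (a k) D ++ nseq (s k) F ++
    flatten [seq nseq (b x) U ++ nseq (a x.+1) D ++ nseq (s x.+1) F
               | x <- iota k m] ++
    nseq (b (k + m)) U = map r (iota k m.+1).
Proof.
elim: m k => [|m IHm] k H.
  by rewrite addn0; have [|-> -> ->] := H k; [lia|rewrite /=; case: (r k)].
rewrite -[RHS]/(r k :: map r (iota k.+1 m.+1)) -IHm; last first.
  by move=> x xk; apply: H; lia.
have [|-> -> bk] := H k; first lia.
by rewrite /= bk addnS addSn -!catA; case: (r k).
Qed.

Lemma letter_range n (w : seq nat) i : perm_eq w (iota 1 n) -> i < size w ->
  1 <= nth 0 w i <= n.
Proof. by move=> pw /(mem_nth 0); rewrite (perm_mem pw) mem_iota add1n. Qed.

Lemma first_letter_role n (w : seq nat) : perm_eq w (iota 1 n) -> 0 < n ->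
  letter_role w 1 != D.
Proof.
move=> pw n_gt0; rewrite role_D; apply/negP => /andP[szi].
have w1 : 1 \in w by rewrite (perm_mem pw) mem_iota; lia.
rewrite (nth_index 0 w1) => lt1.
have := letter_range pw szi; lia.
Qed.

Lemma last_letter_role n (w : seq nat) : perm_eq w (iota 1 n) ->
  skip_increasing w -> 0 < n -> letter_role w n != U.
Proof.
move=> pw skip n_gt0; rewrite role_U //; apply/negP => /andP[i_gt0 /andP[_]].
have wn : n \in w by rewrite (perm_mem pw) mem_iota; lia.
rewrite (prednK i_gt0) (nth_index 0 wn) => lt1.
have szi : (index n w).-1 < size w.
  by rewrite (leq_ltn_trans (leq_pred _)) ?index_mem.
have := letter_range pw szi; lia.
Qed.

Lemma g_letter_roles n (w : seq nat) : perm_eq w (iota 1 n) ->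
  skip_increasing w -> g n w = map (letter_role w) (iota 1 n).
Proof.
move=> pw skip; case: n pw => [|m] // pw.
have uw : uniq w by rewrite (perm_uniq pw) iota_uniq.
have types x : 0 < x <= m.+1 ->
    [/\ num_pair_fst w x = (letter_role w x == D),
        num_singleton w x = (letter_role w x == F) &
        num_pair_snd w x = (letter_role w x == U)].
  move=> x_range; have xw : x \in w by rewrite (perm_mem pw) mem_iota; lia.
  by rewrite num_pair_fstE // num_singletonE // num_pair_sndE.
have -> : g m.+1 w = remove_UD (nseq (num_singleton w 1) F ++
    flatten [seq nseq (T w j) (step_of j) | j <- iota (3 * 0).+1 (3 * m)]).
  by rewrite /g /f; have -> : 3 * m.+1 - 2 = (3 * m).+1 by lia.
rewrite f_blocks remove_UD_F remove_UD_blocks.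
rewrite -(@regroup_blocks (num_pair_fst w) (num_singleton w) (num_pair_snd w));
  last by move=> x xr; apply: types; lia.
have [|-> _ _] := types 1; first lia.
have [|_ _ ->] := types (1 + m); first lia.
rewrite (negPf (first_letter_role pw _)) // add1n.
by rewrite (negPf (last_letter_role pw skip _)) // cats0.
Qed.

(** * Singletons cut the permutation *)

Lemma below_after_ascent w i k : skip_increasing w -> i < size w ->
  (0 < i -> nth 0 w i.-1 < nth 0 w i) -> k < i -> nth 0 w k < nth 0 w i.
Proof.
move=> skip szi up lt_ki; have [m mP] := ubnP (i - k).
elim: m k lt_ki mP => // m IHm k lt_ki mP.
have [e|ki1] := eqVneq k.+1 i; first by rewrite -e in up *; exact: up.
have [e|ki2] := eqVneq k.+2 i; first by rewrite -e in szi *; exact: skip.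
have lt1 : nth 0 w k < nth 0 w k.+2 by apply: skip; lia.
have lt2 : nth 0 w k.+2 < nth 0 w i by apply: IHm; lia.
exact: ltn_trans lt1 lt2.
Qed.

Lemma above_before_ascent w i k : skip_increasing w ->
  (i.+1 < size w -> nth 0 w i < nth 0 w i.+1) -> i < k < size w ->
  nth 0 w i < nth 0 w k.
Proof.
move=> skip up; have [m mP] := ubnP k.
elim: m k mP => // m IHm k mP /andP[lt_ik szk].
have [e|ki1] := eqVneq k i.+1; first by rewrite e in szk *; exact: up.
have [e|ki2] := eqVneq k i.+2; first by rewrite e in szk *; exact: skip.
case: k mP lt_ik szk ki1 ki2 => [|[|k]] mP lt_ik szk ki1 ki2; [lia|lia|].
have lt1 : nth 0 w k < nth 0 w k.+2 by apply: skip; lia.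
have lt2 : nth 0 w i < nth 0 w k by apply: IHm; lia.
exact: ltn_trans lt2 lt1.
Qed.

Lemma not_pair_atE (w : seq nat) i : uniq w -> i.+1 < size w ->
  ~~ pair_at w i = (nth 0 w i < nth 0 w i.+1).
Proof.
move=> uw szi; rewrite /pair_at szi /= -leqNgt leq_eqVlt.
by rewrite nth_uniq ?(ltnW szi) // ltn_eqF.
Qed.

(** A singleton has an ascent on both sides, and jumping by two positions at a
    time compares it with every other letter. *)
Lemma singleton_separates (w : seq nat) x k : uniq w -> skip_increasing w ->
  x \in w -> letter_role w x = F -> k < size w ->
  (nth 0 w k < x) = (k < index x w).
Proof.
move=> uw skip xw /eqP; rewrite role_F ?index_mem //.
case/and3P=> szi no_at no_before.
set i := index x w in szi no_at no_before *; move=> szk.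
have wi : nth 0 w i = x by exact: nth_index.
have [lt_ki|gt_ki|->] := ltngtP k i; last by rewrite wi ltnn.
- rewrite -wi; apply: below_after_ascent => // i_gt0.
  move: no_before; rewrite i_gt0 /= not_pair_atE // ?prednK //.
- suff : nth 0 w i < nth 0 w k by rewrite wi; lia.
  apply: above_before_ascent => // [szi1|]; last by rewrite gt_ki.
  by rewrite -not_pair_atE.
Qed.

Definition allowed (a b : step) : bool :=
  ~~ ((a == U) && (b == F)) && ~~ ((a == F) && (b == D)).

(** In a factor UF the partner of [x] exceeds the singleton [x.+1], and in a
    factor FD the partner of [x.+1] is below the singleton [x].  In both cases
    the two letters of a pair are adjacent, hence on the same side of the
    singleton, while their values lie on both sides of it, against
    [singleton_separates]. *)
Lemma allowed_letter_roles n (w : seq nat) x : perm_eq w (iota 1 n) ->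
  skip_increasing w -> 0 < x -> x < n ->
  allowed (letter_role w x) (letter_role w x.+1).
Proof.
move=> pw skip x_gt0 x_lt.
have uw : uniq w by rewrite (perm_uniq pw) iota_uniq.
have xw : x \in w by rewrite (perm_mem pw) mem_iota; lia.
have x1w : x.+1 \in w by rewrite (perm_mem pw) mem_iota; lia.
apply/andP; split; apply/negP => /andP[].
- rewrite role_U // => /andP[j_gt0]; set j := index x w.
  rewrite /pair_at prednK // (nth_index 0 xw) => /andP[szj lt_x] /eqP rF.
  have sep k := singleton_separates (k := k) uw skip x1w rF.
  have := sep j szj; rewrite (nth_index 0 xw) ltnSn => /esym lt_j.
  have := sep j.-1 (leq_ltn_trans (leq_pred _) szj).
  by rewrite (leq_ltn_trans (leq_pred _) lt_j) ltnNge lt_x.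
- move=> /eqP rF; rewrite role_D; set j := index x.+1 w.
  rewrite /pair_at (nth_index 0 x1w) => /andP[szj lt_x].
  have sep k := singleton_separates (k := k) uw skip xw rF.
  have sepj := sep j (ltnW szj); rewrite (nth_index 0 x1w) in sepj.
  have sepj1 := sep j.+1 szj.
  have wj1 : nth 0 w j.+1 = x by lia.
  have := index_uniq 0 szj uw; rewrite wj1; lia.
Qed.

Lemma sorted_letter_roles n (w : seq nat) : perm_eq w (iota 1 n) ->
  skip_increasing w -> sorted allowed (map (letter_role w) (iota 1 n)).
Proof.
move=> pw skip; rewrite sorted_map; apply/(sortedP 0) => i.
rewrite size_iota => lt_i; rewrite !nth_iota ?(ltnW lt_i) //.
by apply: (allowed_letter_roles pw skip); lia.
Qed.

(** * Counting the steps of the path *)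

(** Listing the roles by value or by position gives the same multiset, so the
    number of steps of a kind can be counted along the positions of [w]. *)
Lemma perm_letter_roles n (w : seq nat) : perm_eq w (iota 1 n) ->
  perm_eq (map (letter_role w) (iota 1 n)) (map (role w) (iota 0 (size w))).
Proof.
move=> pw; have uw : uniq w by rewrite (perm_uniq pw) iota_uniq.
rewrite -(permPl (perm_map _ pw)).
rewrite -{2}[w](mkseq_nth 0) -map_comp.
have /eq_in_map-> // : {in iota 0 (size w), letter_role w \o nth 0 w =1 role w}.
by move=> i; rewrite mem_iota => szi; rewrite /letter_role /= index_uniq.
Qed.

Definition descents w := count (pair_at w) (iota 0 (size w).-1).

Lemma count_pair_at w : count (pair_at w) (iota 0 (size w)) = descents w.
Proof.
rewrite /descents; case E: (size w) => [|m] //; rewrite count_iota_last.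
by rewrite {2}/pair_at E ltnn addn0.
Qed.

Lemma count_letter_roles_D n (w : seq nat) : perm_eq w (iota 1 n) ->
  count_mem D (map (letter_role w) (iota 1 n)) = descents w.
Proof.
move=> pw; rewrite (permP (perm_letter_roles pw)) count_map -count_pair_at.
by apply: eq_count => i; rewrite /= role_D.
Qed.

Lemma count_letter_roles_U n (w : seq nat) : perm_eq w (iota 1 n) ->
  skip_increasing w ->
  count_mem U (map (letter_role w) (iota 1 n)) = descents w.
Proof.
move=> pw skip; rewrite (permP (perm_letter_roles pw)) count_map -count_pair_at.
have := count_pair_before (fun _ _ => true) w.
under eq_count do rewrite andbT; under [RHS]eq_count do rewrite andbT.
by move<-; apply: eq_count => i; rewrite /= role_U.
Qed.

(** As [w_i < w_(i+2)], the letter 1 is at position 0 or 1, and at position 1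
    exactly when the first two letters form a pair. *)
Lemma role_first_letter_U n (w : seq nat) : perm_eq w (iota 1 n) ->
  skip_increasing w -> 0 < n -> (letter_role w 1 == U) = pair_at w 0.
Proof.
move=> pw skip n_gt0.
have uw : uniq w by rewrite (perm_uniq pw) iota_uniq.
have w1 : 1 \in w by rewrite (perm_mem pw) mem_iota; lia.
have szi : index 1 w < size w by rewrite index_mem.
have wi : nth 0 w (index 1 w) = 1 by exact: nth_index.
rewrite role_U //; case: (index 1 w) szi wi => [|[|i]] szi wi //.
  rewrite /pair_before /= /pair_at wi; apply/esym/negP => /andP[sz1].
  have := letter_range pw sz1; lia.
have := skip _ szi; rewrite wi => lt1.
have /letter_range := pw => /(_ i); lia.
Qed.

(** Dually, the letter [n] is at the last position or the one before.  For
    [n <= 1] the truncated index [n.-2] is 0 and starts no pair. *)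
Lemma role_last_letter_D n (w : seq nat) : perm_eq w (iota 1 n) ->
  skip_increasing w -> 0 < n -> (letter_role w n == D) = pair_at w n.-2.
Proof.
move=> pw skip n_gt0.
have uw : uniq w by rewrite (perm_uniq pw) iota_uniq.
have szw : size w = n by rewrite (perm_size pw) size_iota.
have wn : n \in w by rewrite (perm_mem pw) mem_iota; lia.
have szi : index n w < size w by rewrite index_mem.
have wi : nth 0 w (index n w) = n by exact: nth_index.
rewrite role_D; move: (index n w) szi wi => i szi wi.
have [->|ne2] := eqVneq i n.-2; first by [].
have [e|ne1] := eqVneq i n.-1.
  have e2 : n.-2.+1 = n.-1 by lia.
  rewrite e in wi; rewrite /pair_at e prednK // szw ltnn /= e2 wi.
  apply/esym/negP => /andP[sz1]; have sz2 : n.-2 < size w by lia.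
  have := letter_range pw sz2; lia.
have sz2 : i.+2 < size w by lia.
have := skip _ sz2; rewrite wi; have := letter_range pw sz2; lia.
Qed.

(** * Factors of a path *)

Lemma factors_cons (A : Type) m (x : A) s : 0 < m <= (size s).+1 ->
  factors m (x :: s) = take m (x :: s) :: factors m s.
Proof.
move=> m_le; rewrite /factors /= subSn; last by case/andP: m_le.
by rewrite /= (iotaDl 1 0) -map_comp.
Qed.

Lemma occ_path1 a P : occ_path [:: a] P = count_mem a P.
Proof.
rewrite /occ_path; elim: P => // x P IHP.
by rewrite factors_cons //= IHP take0 eqseq_cons andbT.
Qed.

Lemma occ_path2_cons a b x y P :
  occ_path [:: a; b] (x :: y :: P) =
  ((x == a) && (y == b)) + occ_path [:: a; b] (y :: P).
Proof. by rewrite /occ_path factors_cons //= take0 !eqseq_cons andbT. Qed.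

Lemma occ_path3_cons a b c x y z P :
  occ_path [:: a; b; c] (x :: y :: z :: P) =
  [&& x == a, y == b & z == c] + occ_path [:: a; b; c] (y :: z :: P).
Proof. by rewrite /occ_path factors_cons //= take0 !eqseq_cons andbT. Qed.

Lemma occ_path_into b x P :
  occ_path [:: F; b] (x :: P) + occ_path [:: U; b] (x :: P)
  + occ_path [:: D; b] (x :: P) + (x == b) = count_mem b (x :: P).
Proof.
elim: P x => [|y P IHP] x; first by rewrite /= addn0.
rewrite !occ_path2_cons [count_mem b _]/=
  -[_ + count _ _]/(count_mem b (y :: P)).
rewrite -IHP; case: x; rewrite /=; lia.
Qed.

Lemma occ_path_from a x P :
  occ_path [:: a; F] (x :: P) + occ_path [:: a; U] (x :: P)
  + occ_path [:: a; D] (x :: P) + (last x P == a) = count_mem a (x :: P).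
Proof.
elim: P x => [|y P IHP] x; first by rewrite /= addn0.
rewrite !occ_path2_cons [count_mem a _]/=
  -[_ + count _ _]/(count_mem a (y :: P)).
rewrite -IHP; case: y; rewrite /= ?andbT ?andbF; lia.
Qed.

Lemma occ_path_forbidden P : sorted allowed P ->
  occ_path [:: U; F] P = 0 /\ occ_path [:: F; D] P = 0.
Proof.
case: P => // x P; elim: P x => // y P IHP x /= /andP[xy /IHP[UF FD]].
by rewrite !occ_path2_cons UF FD; case: x y xy {UF FD} => [] [].
Qed.

Lemma count_steps P : count_mem F P + count_mem U P + count_mem D P = size P.
Proof. by elim: P => // -[] P /= <-; lia. Qed.

(** Before an F only D and F are allowed, and after it only F and U, so every
    interior F is the middle of one of the four factors. *)
Lemma count_F_interior x P : sorted allowed (x :: P) -> 0 < size P ->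
  occ_path [:: D; F; U] (x :: P) + occ_path [:: D; F; F] (x :: P)
  + occ_path [:: F; F; U] (x :: P) + occ_path [:: F; F; F] (x :: P)
  + (x == F) + (last x P == F) = count_mem F (x :: P).
Proof.
case: P => // y P okP _; elim: P x y okP => [|z P IHP] x y /=.
  by rewrite addn0.
move=> /andP[xy yP]; have := IHP y z yP; case/andP: yP => yz _.
rewrite !occ_path3_cons /=.
by case: x xy; case: y yz; case: z => //= _ _; lia.
Qed.

(** * Consecutive patterns in a faro permutation *)

(** Unlike the quantifiers over ordinals, this form evaluates on explicit
    sequences. *)
Lemma order_isomorphicE s p : order_isomorphic s p =
  (size s == size p) &&
  all (fun i => all (fun j => (nth 0 s i < nth 0 s j) == (nth 0 p i < nth 0 p j))
                    (iota 0 (size p))) (iota 0 (size p)).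
Proof.
congr (_ && _); apply/forallP/allP => [iso i|iso i].
  rewrite mem_iota => /= lt_i; apply/allP => j; rewrite mem_iota => /= lt_j.
  exact: (forallP (iso (Ordinal lt_i)) (Ordinal lt_j)).
apply/forallP => j.
by have /iso/allP/(_ j)-> : val i \in iota 0 (size p); rewrite ?mem_iota /=.
Qed.

Lemma occ_permE p w (q : pred nat) :
  (forall i, i + size p <= size w ->
     order_isomorphic [seq nth 0 w j | j <- iota i (size p)] p = q i) ->
  occ_perm p w = count q (iota 0 ((size w).+1 - size p)).
Proof.
move=> iso; rewrite /occ_perm /factors count_map.
apply: eq_in_count => i; rewrite mem_iota => /= lt_i.
by rewrite -(map_nth_iota 0) ?iso //; lia.
Qed.

Lemma occ_perm_21 w : occ_perm [:: 2; 1] w = descents w.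
Proof.
rewrite (@occ_permE _ _ (pair_at w)) ?subSS ?subn1 // => i /= szi.
have szi1 : i.+1 < size w by lia.
by rewrite order_isomorphicE /= /pair_at szi1 /= !ltnn /=; lia.
Qed.

Lemma occ_perm_12 (w : seq nat) : uniq w ->
  occ_perm [:: 1; 2] w + descents w = (size w).-1.
Proof.
move=> uw; rewrite (@occ_permE _ _ (predC (pair_at w))).
  by rewrite subSS subn1 addnC count_predC size_iota.
move=> i /= szi; have szi1 : i.+1 < size w by lia.
by rewrite not_pair_atE // order_isomorphicE /= !ltnn; lia.
Qed.

Lemma occ_perm_132E w : skip_increasing w ->
  occ_perm [:: 1; 3; 2] w =
  count (fun i => pair_at w i.+1) (iota 0 (size w).-2).
Proof.
move=> skip; rewrite (@occ_permE _ _ (fun i => pair_at w i.+1)) ?subSS ?subn2 //.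
move=> i /= szi; have szi2 : i.+2 < size w by lia.
have := skip _ szi2.
by rewrite order_isomorphicE /= /pair_at szi2 !ltnn /=; lia.
Qed.

Lemma occ_perm_213E w : skip_increasing w ->
  occ_perm [:: 2; 1; 3] w = count (pair_at w) (iota 0 (size w).-2).
Proof.
move=> skip; rewrite (@occ_permE _ _ (pair_at w)) ?subSS ?subn2 //.
move=> i /= szi; have szi2 : i.+2 < size w by lia.
have := skip _ szi2.
by rewrite order_isomorphicE /= /pair_at (ltnW szi2) !ltnn /=; lia.
Qed.

Lemma occ_perm_123E (w : seq nat) : uniq w ->
  occ_perm [:: 1; 2; 3] w =
  count (fun i => ~~ pair_at w i && ~~ pair_at w i.+1) (iota 0 (size w).-2).
Proof.
move=> uw.
rewrite (@occ_permE _ _ (fun i => ~~ pair_at w i && ~~ pair_at w i.+1))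
  ?subSS ?subn2 // => i /= szi; have szi2 : i.+2 < size w by lia.
by rewrite !not_pair_atE ?(ltnW szi2) // order_isomorphicE /= !ltnn /=; lia.
Qed.

Lemma occ_perm_132 w : skip_increasing w ->
  occ_perm [:: 1; 3; 2] w + pair_at w 0 = descents w.
Proof.
move=> skip; rewrite occ_perm_132E // /descents -count_iota_succ.
case e: (size w) => [|[|m]]; last by rewrite addnC.
all: by rewrite /pair_at e.
Qed.

Lemma occ_perm_213 w : skip_increasing w ->
  occ_perm [:: 2; 1; 3] w + pair_at w (size w).-2 = descents w.
Proof.
move=> skip; rewrite occ_perm_213E // /descents.
case e: (size w) => [|[|m]]; last by rewrite [RHS]count_iota_last.
all: by rewrite /pair_at e.
Qed.

(** A window has at most one descent, and the three patterns are told apart by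
    whether it comes first (213), second (132) or not at all (123). *)
Lemma occ_perm_123 (w : seq nat) : uniq w -> skip_increasing w ->
  occ_perm [:: 1; 2; 3] w + occ_perm [:: 1; 3; 2] w + occ_perm [:: 2; 1; 3] w =
  (size w).-2.
Proof.
move=> uw skip; rewrite occ_perm_123E // occ_perm_132E // occ_perm_213E //.
elim: (size w).-2 => // m IHm; rewrite !count_iota_last /=.
case E: (pair_at w m); last by case: (pair_at w m.+1); lia.
by rewrite (negPf (pairs_disjoint skip E)); lia.
Qed.

(** These patterns start with a letter larger than their last one. *)
Lemma occ_perm0 p (w : seq nat) : uniq w -> skip_increasing w ->
  p \in [:: [:: 2; 3; 1]; [:: 3; 1; 2]; [:: 3; 2; 1]] -> occ_perm p w = 0.
Proof.
move=> uw skip p_in; rewrite (@occ_permE _ _ pred0) ?count_pred0 // => i.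
have -> : size p = 3 by move: p_in; rewrite !inE => /or3P[] /eqP->.
move=> szi; have szi2 : i.+2 < size w by lia.
have := skip _ szi2; rewrite order_isomorphicE /=.
by move: p_in; rewrite !inE => /or3P[] /eqP-> /=; lia.
Qed.

Lemma map_iota_ends (r : nat -> step) n x s : x :: s = map r (iota 1 n) ->
  x = r 1 /\ last x s = r n.
Proof.
case: n => // m hP; split; first by case: hP.
rewrite -[last x s]/(last x (x :: s)) hP.
by have := iotaD 1 m 1; rewrite addn1 => ->; rewrite map_cat last_cat.
Qed.

(** * Statistics of a faro permutation and of its path *)

Theorem theorem3p4 (n : nat) (w : seq nat) (hw : faro_permutation n w)
    (P : seq step) (hP : P = g n w) :
  occ_perm [:: 2; 1] w = occ_path [:: U] P /\
  (occ_perm [:: 1; 2] w =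
     occ_path [:: D; U] P + occ_path [:: D; D] P + occ_path [:: D; F] P
     + occ_path [:: F; F] P + occ_path [:: F; U] P /\
   ((1 <= n)%N ->
     (occ_perm [:: 1; 2]%N w)%:Z = n%:Z - 1 - (occ_path [:: U] P)%:Z :> int)%R) /\
  occ_perm [:: 1; 3; 2] w =
    occ_path [:: F; U] P + occ_path [:: U; U] P + occ_path [:: D; U] P /\
  occ_perm [:: 2; 1; 3] w =
    occ_path [:: D; F] P + occ_path [:: D; D] P + occ_path [:: D; U] P /\
  (occ_perm [:: 1; 2; 3] w =
     occ_path [:: D; F; U] P + occ_path [:: D; F; F] P
     + occ_path [:: F; F; U] P + occ_path [:: F; F; F] P /\
   ((2 <= n)%N ->
     (occ_perm [:: 1; 2; 3]%N w)%:Z =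
       n%:Z - 2 - (occ_path [:: F; U] P)%:Z - (occ_path [:: U; U] P)%:Z
       - 2 * (occ_path [:: D; U] P)%:Z - (occ_path [:: D; F] P)%:Z
       - (occ_path [:: D; D] P)%:Z :> int)%R) /\
  (occ_perm [:: 2; 3; 1] w = 0 /\ occ_perm [:: 3; 1; 2] w = 0 /\
   occ_perm [:: 3; 2; 1] w = 0).
Proof.
have pw := faro_permutation_perm hw.
have uw := faro_permutation_uniq hw.
have skip := faro_permutation_skip hw.
have szw : size w = n by rewrite (perm_size pw) size_iota.
have e12 := occ_perm_12 uw.
have e132 := occ_perm_132 skip.
have e213 := occ_perm_213 skip.
have e123 := occ_perm_123 uw skip.
rewrite szw in e12 e213 e123; rewrite g_letter_roles // in hP.
have cU : count_mem U P = descents w by rewrite hP; exact: count_letter_roles_U.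
have cD : count_mem D P = descents w by rewrite hP; exact: count_letter_roles_D.
have szP : size P = n by rewrite hP size_map size_iota.
have okP : sorted allowed P by rewrite hP; exact: sorted_letter_roles.
have [UF FD] := occ_path_forbidden okP.
rewrite occ_perm_21 occ_path1 cU.
rewrite (@occ_perm0 [:: 2; 3; 1]) // (@occ_perm0 [:: 3; 1; 2]) //.
rewrite (@occ_perm0 [:: 3; 2; 1]) //.
case: P hP cU cD szP okP UF FD => [|x s] hP cU cD szP okP UF FD.
  have w0 : w = [::] by apply: size0nil; rewrite szw -szP.
  by rewrite w0 -szP.
have n_gt0 : 0 < n by rewrite -szP.
have [hx hlast] := map_iota_ends hP.
have xD : (x == D) = false.
  by rewrite hx; exact: negbTE (first_letter_role pw n_gt0).
have xU : (x == U) = pair_at w 0.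
  by rewrite hx; exact: role_first_letter_U pw skip n_gt0.
have lU : (last x s == U) = false.
  by rewrite hlast; exact: negbTE (last_letter_role pw skip n_gt0).
have lD : (last x s == D) = pair_at w n.-2.
  by rewrite hlast; exact: role_last_letter_D pw skip n_gt0.
have one_step a : (a == F) + (a == U) + (a == D) = 1 by case: a.
have oneX := one_step x; have oneL := one_step (last x s).
have cF := count_steps (x :: s); rewrite szP cU cD in cF.
have intoU := occ_path_into U x s.
have fromD := occ_path_from D x s; have fromF := occ_path_from F x s.
rewrite xD xU in oneX; rewrite lU lD in oneL; rewrite cU xU in intoU.
rewrite cD lD in fromD.
have e123F : occ_perm [:: 1; 2; 3] w =
    occ_path [:: D; F; U] (x :: s) + occ_path [:: D; F; F] (x :: s)
    + occ_path [:: F; F; U] (x :: s) + occ_path [:: F; F; F] (x :: s).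
  have [s0|s_gt0] := posnP (size s).
    have -> : s = [::] by exact: size0nil.
    by transitivity 0 => //; move: e123; rewrite -szP /= s0; clear; lia.
  have := count_F_interior okP s_gt0.
  have : 1 < n by rewrite -szP.
  move: e123 e132 e213 cF oneX oneL; clear => ? ? ? ? ? ? ?; lia.
clear - e12 e132 e213 e123 e123F UF FD cF oneX oneL intoU fromD fromF n_gt0.
do !split; lia.
Qed.
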